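(* A nonzero subspace $U\subseteq V=H\otimes E$ is nilpotent of degree $1$ if and only if it is a decomposable subspace $h\otimes F$, $F\subseteq E$. More generally, let $A\in\widetilde Q$ be a nonzero nilpotent endomorphism and let $\ker A=h\otimes E$. A nonzero subspace $U$ is $A$-nilpotent if and only if, with respect to a symplectic basis $(h_1\equiv h,h_2)$ of $H$, one has $$h_1\otimes p_2(U)\subseteq U.$$
   Context: $H$ is a real vector space of dimension $2$ with symplectic form $\omega^H$, $E$ a real vector space of dimension $2n$, $V=H\otimes E$, and $\widetilde Q=\mathfrak{sl}(H)\otimes\mathrm{Id}\subset\mathrm{End}(V)$ (trace-free endomorphisms of $H$ acting on the first factor). A symplectic basis $(h_1,h_2)$ of $H$ is one with $\omega^H(h_1,h_2)=1$. Given it, each $X\in V$ is uniquely $X=h_1\otimes e+h_2\otimes e'$, and $p_1(X)=e$, $p_2(X)=e'$. A decomposable subspace is a nonzero subspace of the form $h\otimes F=\{h\otimes f:f\in F\}$ with $h\in H$ and $F\subseteq E$ a subspace. A subspace $U\neq\{0\}$ of $V$ is nilpotent (or $A$-nilpotent) if there is a nonzero nilpotent endomorphism $A\in\widetilde Q$ with $AU\subseteq U$. The degree of nilpotency of a nilpotent subspace $U$ is the minimum integer $n$ such that $A^nU=\{0\}$ for some such $A$; since $A^2=0$ it is at most $2$, and it is $1$ when $U\subseteq\ker A$. *)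

(* Defs.v *)
From HB Require Import structures.
From mathcomp Require Import all_boot all_order all_algebra.
From mathcomp Require Import boolp classical_sets reals.

Set Implicit Arguments.
Unset Strict Implicit.
Unset Printing Implicit Defensive.

Import GRing.Theory.
Import passmx VectorInternalTheory.
Local Open Scope classical_set_scope.
Local Open Scope ring_scope.

Definition lfun_trace (F : fieldType) (T : vectType F) (f : 'End(T)) : F :=
  \tr (mxof (vbasis {:T}) (vbasis {:T}) f).

Definition lfun_exp (F : fieldType) (T : vectType F) (f : 'End(T)) (k : nat) :
  'End(T) := iter k (fun g => (f \o g)%VF) \1%VF.

Definition nilpotent_lfun (F : fieldType) (T : vectType F) (f : 'End(T)) :
  Prop := exists k : nat, lfun_exp f k = 0.

(* Universal property of the tensor product; [t h e] stands for the
   decomposable tensor of h and e. *)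
Definition is_tensor_product (F : fieldType) (H E V : vectType F)
    (t : {bilinear H -> E -> V}) : Prop :=
  forall (W : lmodType F) (b : {bilinear H -> E -> W}),
    exists2 g : {linear V -> W}, (forall h e, g (t h e) = b h e) &
      forall g' : {linear V -> W}, (forall h e, g' (t h e) = b h e) -> g' =1 g.

Section TensorSubspaces.
Variables (F : fieldType) (H E V : vectType F) (t : {bilinear H -> E -> V}).

Definition tensor_set (h : H) (S : set E) : set V := [set t h e | e in S].

Definition decomposable (U : {vspace V}) : Prop :=
  U != 0%VS /\
  exists (h : H) (S : {vspace E}), [set` U] = tensor_set h [set` S].

(* sl(H) (x) Id, where B (x) Id is pinned down by its values on t h e. *)
Definition in_Qtilde (A : 'End(V)) : Prop :=
  exists2 B : 'End(H), lfun_trace B = 0 & forall h e, A (t h e) = t (B h) e.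

Definition Qtilde_nilpotent (A : 'End(V)) : Prop :=
  [/\ in_Qtilde A, A != 0 & nilpotent_lfun A].

(* "U is A-nilpotent"; the condition U != 0 is part of the notion. *)
Definition nilpotent_by (A : 'End(V)) (U : {vspace V}) : Prop :=
  [/\ U != 0%VS, Qtilde_nilpotent A & (A @: U <= U)%VS].

Definition nilpotent_subspace (U : {vspace V}) : Prop :=
  exists A : 'End(V), nilpotent_by A U.

(* A^k U = 0 for some A as in nilpotent_subspace, A depending on k. *)
Definition killed_in (U : {vspace V}) (k : nat) : Prop :=
  exists2 A : 'End(V), nilpotent_by A U & (lfun_exp A k @: U = 0)%VS.

Definition nilpotent_of_degree (U : {vspace V}) (k : nat) : Prop :=
  [/\ nilpotent_subspace U, killed_in U k &
      forall j : nat, killed_in U j -> (k <= j)%N].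

(* For a basis (h1, h2) of H the pair is determined by X, see
   tensor_coordsP; the value (0, 0) is a default. *)
Definition tensor_coords (h1 h2 : H) (X : V) : E * E :=
  xget (0, 0) [set p | X = t h1 p.1 + t h2 p.2].

Definition p1 (h1 h2 : H) (X : V) : E := (tensor_coords h1 h2 X).1.
Definition p2 (h1 h2 : H) (X : V) : E := (tensor_coords h1 h2 X).2.

End TensorSubspaces.

Definition symplectic_basis (F : fieldType) (H : vectType F)
    (w : {skew_symmetric H}) (h1 h2 : H) : Prop :=
  basis_of {:H} [:: h1; h2] /\ w h1 h2 = 1.

Lemma lfun_trace_basis (F : fieldType) (T : vectType F)
    (e : (\dim {:T}).-tuple T) (f : 'End(T)) :
  basis_of {:T} e -> \tr (mxof e e f) = lfun_trace f.
Proof.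
move=> eB; rewrite /lfun_trace; set b := vbasis _.
have bB : basis_of {:T} b by exact: vbasisP.
have f_bb : mxof b b f = mxof b e \1 *m (mxof e e f *m mxof e b \1).
  by rewrite -(mxof_comp e b eB) comp_lfun1l -(mxof_comp b b eB) comp_lfun1r.
rewrite f_bb mxtrace_mulC -mulmxA -(mxof_comp e e bB) comp_lfun1l.
by rewrite mxof1 ?mulmx1 ?(basis_free eB).
Qed.

Section TensorCoords.
Variables (F : fieldType) (H E V : vectType F) (t : {bilinear H -> E -> V}).
Variables h1 h2 : H.

Let c (i : 'I_2) (h : H) : F := coord [tuple h1; h2] i h.

Let coord_bil (h : H) (e : E) : (E * E)%type :=
  (c ord0 h *: e, c ord_max h *: e).

Let coord_bil_bilinear :
  bilinear_for (GRing.Scale.Law.clone _ _ *:%R _)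
    (GRing.Scale.Law.clone _ _ *:%R _) coord_bil.
Proof.
have cP i a x y : c i (a *: x + y) = a * c i x + c i y by rewrite /c linearP.
split=> [e|h] a x y; rewrite /coord_bil; congr (_, _) => /=.
- by rewrite cP scalerDl -scalerA.
- by rewrite cP scalerDl -scalerA.
- by rewrite scalerDr !scalerA mulrC.
- by rewrite scalerDr !scalerA mulrC.
Qed.

HB.instance Definition _ := bilinear_isBilinear.Build F H E (E * E)%type
  _ _ coord_bil coord_bil_bilinear.

Let merge (p : E * E) : V := t h1 p.1 + t h2 p.2.

Let merge_linear : linear merge.
Proof.
by move=> a p q; rewrite /merge /= !linearP /= scalerDr addrACA.
Qed.

HB.instance Definition _ := GRing.isLinear.Build F (E * E)%type V _ merge
  merge_linear.

Lemma tensor_coords_unique_ex :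
  is_tensor_product t -> basis_of {:H} [:: h1; h2] ->
  forall X : V, exists! p : E * E, X = t h1 p.1 + t h2 p.2.
Proof.
move=> tP hB X.
have [g gt _] := tP _ coord_bil.
have hB' : basis_of {:H} [tuple h1; h2] by [].
have hF : free [tuple h1; h2] by exact: basis_free hB.
have c1 : (c ord0 h1 = 1) /\ (c ord_max h1 = 0).
  by split; have := coord_free ord0 _ hF; rewrite /c => ->.
have c2 : (c ord0 h2 = 0) /\ (c ord_max h2 = 1).
  by split; have := coord_free ord_max _ hF; rewrite /c => ->.
have [k _ kU] := tP _ t.
have mg : (merge \o g) X = X.
  transitivity (k X); first apply: (kU (merge \o g)) => h e /=.
    rewrite gt /merge /= !linearZr_LR /= -!linearZl_LR -linearDl; congr (t _ e).
    rewrite [RHS](coord_basis hB') ?memvf //.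
    rewrite big_ord_recl big_ord1; congr (_ + c _ h *: _); exact: val_inj.
  by symmetry; apply: (kU idfun).
exists (g X); split; first by rewrite -[LHS]mg.
move=> [e e'] /= ->; rewrite linearD /= !gt /coord_bil.
rewrite -[LHS]/(c ord0 h1 *: e + c ord0 h2 *: e',
                c ord_max h1 *: e + c ord_max h2 *: e').
by rewrite c1.1 c1.2 c2.1 c2.2 !scale1r !scale0r addr0 add0r.
Qed.

Lemma tensor_coordsP :
  is_tensor_product t -> basis_of {:H} [:: h1; h2] ->
  forall (X : V) (e e' : E),
    X = t h1 e + t h2 e' <-> p1 t h1 h2 X = e /\ p2 t h1 h2 X = e'.
Proof.
move=> tP hB X e e'.
have [p [/= pX pU]] := tensor_coords_unique_ex tP hB X.
have Xc : X = t h1 (p1 t h1 h2 X) + t h2 (p2 t h1 h2 X).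
  by rewrite /p1 /p2 /tensor_coords; case: xgetP => //= /(_ p) [].
split=> [Xe|[<- <-]] //.
by have := pU (e, e') Xe; have := pU (_, _) Xc => -> [-> ->].
Qed.

End TensorCoords.

(* is_tensor_product is inhabited: outer products of coordinate vectors. *)
Section MatrixTensor.
Variables (F : fieldType) (H E : vectType F).
Let m := dim H.
Let n := dim E.

Definition matrix_tensor (h : H) (e : E) : 'M[F]_(m, n) :=
  \matrix_(i, j) (v2r h 0 i * v2r e 0 j).

Let matrix_tensor_bilinear :
  bilinear_for (GRing.Scale.Law.clone _ _ *:%R _)
    (GRing.Scale.Law.clone _ _ *:%R _) matrix_tensor.
Proof.
split=> [e|h] a x y; apply/matrixP => i j; rewrite !mxE linearP !mxE.
  by rewrite mulrDl mulrA.
by rewrite mulrDr mulrCA.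
Qed.

HB.instance Definition _ := bilinear_isBilinear.Build F H E 'M[F]_(m, n)
  _ _ matrix_tensor matrix_tensor_bilinear.

Lemma matrix_tensorP : is_tensor_product matrix_tensor.
Proof.
move=> W b.
pose dH i : H := r2v (delta_mx 0 i); pose dE j : E := r2v (delta_mx 0 j).
pose g (M : 'M[F]_(m, n)) : W := \sum_i \sum_j M i j *: b (dH i) (dE j).
have gL : linear g.
  move=> a M N; rewrite /g scaler_sumr -big_split; apply: eq_bigr => i _ /=.
  rewrite scaler_sumr -big_split; apply: eq_bigr => j _ /=.
  by rewrite !mxE scalerDl scalerA.
pose gI := GRing.isLinear.Build F 'M[F]_(m, n) W _ g gL.
pose gl : {linear 'M[F]_(m, n) -> W} := HB.pack g gI.
have bE h e : b h e = \sum_i \sum_j (v2r h 0 i * v2r e 0 j) *: b (dH i) (dE j).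
  have hE : h = \sum_i v2r h 0 i *: dH i.
    rewrite -[LHS]v2rK [X in r2v X]row_sum_delta linear_sum.
    by apply: eq_bigr => i _; rewrite linearZ.
  have eE : e = \sum_j v2r e 0 j *: dE j.
    rewrite -[LHS]v2rK [X in r2v X]row_sum_delta linear_sum.
    by apply: eq_bigr => i _; rewrite linearZ.
  rewrite {1}hE linear_sumlz; apply: eq_bigr => i _.
  rewrite linearZl_LR /= {1}eE linear_sumr scaler_sumr; apply: eq_bigr => j _.
  by rewrite linearZr_LR /= scalerA.
exists gl => [h e|g' g'E M].
  rewrite bE; apply: eq_bigr => i _; apply: eq_bigr => j _.
  by rewrite mxE.
rewrite [M in LHS]matrix_sum_delta linear_sum; apply: eq_bigr => i _.
rewrite linear_sum; apply: eq_bigr => j _; rewrite linearZ -g'E; congr (_ *: g' _).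
apply/matrixP => k l; rewrite !mxE !r2vK !mxE eqxx /=.
by case: (k == i); case: (l == j); rewrite ?mulr1 ?mulr0.
Qed.

End MatrixTensor.

(* Main.v *)
(* An element of sl(H) killing h sends any h2 completing h to a basis into the
   line of h, since its trace is its h2-coefficient there.  So A in Q~ with
   A (h (x) e) = 0 acts as A (h (x) e + h2 (x) e') = a (h (x) e') for one scalar
   a, which is nonzero unless A = 0.  Hence ker A = h (x) E, and A U <= U says
   exactly h (x) p2 U <= U. *)
Require Import Defs.
From HB Require Import structures.
From mathcomp Require Import all_boot all_order all_algebra.
From mathcomp Require Import boolp classical_sets reals.
Import GRing.Theory.
Local Open Scope classical_set_scope.
Local Open Scope ring_scope.

Set Implicit Arguments.
Unset Strict Implicit.
Unset Printing Implicit Defensive.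

(** * Traces and coordinates relative to a given basis *)

Lemma lfun_trace_coord (F : fieldType) (T : vectType F) (m : nat)
    (e : m.-tuple T) (f : 'End(T)) :
  basis_of {:T} e -> lfun_trace f = \sum_(i < m) coord e i (f e`_i).
Proof.
(* [lfun_trace_basis] wants a tuple of length [\dim {:T}], so [m] is replaced by that dimension
   throughout. *)
move=> eB; have dT := size_basis eB; case: m / dT e eB => e eB.
rewrite -(lfun_trace_basis f eB) /mxtrace; apply: eq_bigr => i _.
by rewrite /passmx.mxof mxE /= passmx.vecof_delta mxE.
Qed.

Lemma basis_of_pair (F : fieldType) (T : vectType F) (x : T) :
  \dim {:T} = 2%N -> x != 0 -> exists y, basis_of {:T} [:: x; y].
Proof.
move=> dT x0.
have /subvPn[y _ yx] : ~~ ({:T} <= <[x]>)%VS.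
  by apply/negP => /dimvS; rewrite dT dim_vline x0.
have yxF : free [:: y; x] by rewrite free_cons seq1_free span_seq1 yx.
have xyF : free [:: x; y] by rewrite (perm_free (permEl (perm_catC [:: x] [:: y]))).
by exists y; rewrite basisEfree xyF subvf dT.
Qed.

Lemma basis_pair_coords (F : fieldType) (T : vectType F) (x y : T) (v : T) :
  basis_of {:T} [:: x; y] ->
  v = coord [tuple x; y] ord0 v *: x + coord [tuple x; y] ord_max v *: y.
Proof.
move=> xyB; rewrite {1}(@coord_basis _ _ _ _ [tuple x; y] v xyB (memvf v)).
rewrite big_ord_recl big_ord1; congr (_ + coord _ _ _ *: _); exact: val_inj.
Qed.

Lemma basis_pair_trace (F : fieldType) (T : vectType F) (x y : T)
    (f : 'End(T)) :
  basis_of {:T} [:: x; y] ->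
  lfun_trace f = coord [tuple x; y] ord0 (f x) + coord [tuple x; y] ord_max (f y).
Proof.
move=> xyB; rewrite (@lfun_trace_coord _ _ _ [tuple x; y] f xyB).
rewrite big_ord_recl big_ord1; congr (_ + coord _ _ _); exact: val_inj.
Qed.

(** * Coordinates on [V] and the nilpotent elements of [Q~] *)

Section Tensor.
Variables (F : fieldType) (H E V : vectType F) (t : {bilinear H -> E -> V}).
Hypothesis tP : is_tensor_product t.

Section Basis.
Variables h1 h2 : H.
Hypothesis hB : basis_of {:H} [:: h1; h2].

Lemma tensor_decomp (X : V) :
  X = t h1 (p1 t h1 h2 X) + t h2 (p2 t h1 h2 X).
Proof. exact/(tensor_coordsP tP hB). Qed.

Lemma p2_tensor (e e' : E) : p2 t h1 h2 (t h1 e + t h2 e') = e'.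
Proof. by have /(tensor_coordsP tP hB)[] := erefl (t h1 e + t h2 e'). Qed.

(** [p2] comes from a choice operator, so linearity rests on uniqueness of coordinates: [a *: X + Y]
    is regrouped along [h1] and [h2]. It makes the shear built from [p2] an endomorphism of [V]. *)
Lemma p2_linear : linear (p2 t h1 h2).
Proof.
move=> a X Y; rewrite {1}(tensor_decomp X) {1}(tensor_decomp Y).
rewrite scalerDr addrACA -!linearZr_LR -!linearDr; exact: p2_tensor.
Qed.

(** If k = a h1 + b h2, the coordinates of [t k e] are [a *: e] and [b *: e]; comparing them with
    those of 0 gives a = b = 0 as soon as [e] is nonzero. *)
Lemma tensor_eq0 (k : H) (e : E) : (t k e == 0) = (k == 0) || (e == 0).
Proof.
apply/eqP/orP => [tke0|[/eqP->|/eqP->]]; last 2 first.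
- exact: linear0l.
- exact: linear0r.
have [_|e0] := eqVneq e 0; [by right | left].
have kE := basis_pair_coords k hB.
have [z1 z2] : p1 t h1 h2 (0 : V) = 0 /\ p2 t h1 h2 (0 : V) = 0.
  by apply/(tensor_coordsP tP hB); rewrite !linear0r addr0.
move: (kE); set a := coord _ _ _; set b := coord _ _ _ => kab.
have : (0 : V) = t h1 (a *: e) + t h2 (b *: e).
  by rewrite -tke0 kab linearDl linearZl_LR linearZl_LR !linearZr_LR.
move=> /(tensor_coordsP tP hB)[]; rewrite z1 z2 => /esym/eqP + /esym/eqP.
rewrite !scaler_eq0 (negPf e0) !orbF => /eqP a0 /eqP b0.
by rewrite kab a0 b0 !scale0r addr0.
Qed.

Lemma Qtilde_shear (A : 'End(V)) :
  in_Qtilde t A -> (forall e, A (t h1 e) = 0) -> A != 0 ->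
  exists2 a : F, a != 0 & forall X, A X = a *: t h1 (p2 t h1 h2 X).
Proof.
move=> [B trB AB] Ah1 A0.
have AE X : A X = t (B h2) (p2 t h1 h2 X).
  by rewrite {1}(tensor_decomp X) linearD /= Ah1 add0r AB.
(* Such an [X] has a nonzero second coordinate, and a nonzero vector of [E] is what allows passing
   from [A (t h1 e) = 0] to [B h1 = 0]. *)
have [X AX0] : exists X, A X != 0.
  apply: contrapT => /forallNP AX; move/eqP: A0; apply; apply/lfunP => X.
  by rewrite zero_lfunE; apply/eqP/negPn/negP; exact: AX.
have pX0 : p2 t h1 h2 X != 0.
  by apply: contraNneq AX0 => pX; rewrite AE pX linear0r.
have Bh1 : B h1 = 0.
  have /eqP := Ah1 (p2 t h1 h2 X).
  by rewrite AB tensor_eq0 (negPf pX0) orbF => /eqP.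
have := basis_pair_trace B hB; rewrite trB Bh1 linear0 add0r => c0.
have := basis_pair_coords (B h2) hB; rewrite -c0 scale0r addr0.
set a := coord _ _ _ => Bh2; exists a => [|Y]; last by rewrite AE Bh2 linearZl_LR.
by apply: contraNneq AX0 => a0; rewrite AE Bh2 a0 scale0r linear0l.
Qed.

(** Converse of [Qtilde_shear], producing the operator that a decomposable subspace needs. The
    vector [e] witnesses that the shear is nonzero, through its value at [t h2 e]. *)
Lemma shear_Qtilde_nilpotent (e : E) : e != 0 ->
  exists2 A : 'End(V), Qtilde_nilpotent t A &
    forall X, A X = t h1 (p2 t h1 h2 X).
Proof.
move=> e0.
have h1F : h1 != 0.
  move: hB; rewrite basisEfree free_cons => /andP[/andP[h1N _] _].
  by apply: contraNneq h1N => ->; rewrite mem0v.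
have fL : linear (fun X => t h1 (p2 t h1 h2 X)).
  by move=> a X Y; rewrite p2_linear linearP.
pose fI := GRing.isLinear.Build F V V _ _ fL.
pose f : {linear V -> V} := HB.pack (fun X => t h1 (p2 t h1 h2 X)) fI.
(* The factor on [H]: it sends h1 to 0 and h2 to h1, hence has trace 0, and the shear is its tensor
   product with the identity of [E]. *)
have gL : linear (fun k => coord [tuple h1; h2] ord_max k *: h1).
  by move=> a x y; rewrite linearP scalerDl scalerA.
pose gI := GRing.isLinear.Build F H H _ _ gL.
pose g : {linear H -> H} :=
  HB.pack (fun k => coord [tuple h1; h2] ord_max k *: h1) gI.
have p2h1 x : p2 t h1 h2 (t h1 x) = 0.
  by have := p2_tensor x 0; rewrite linear0r addr0.
have p2h2 x : p2 t h1 h2 (t h2 x) = x.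
  by have := p2_tensor 0 x; rewrite linear0r add0r.
have fE X : linfun f X = t h1 (p2 t h1 h2 X) by rewrite lfunE.
have hF : free [tuple h1; h2] by exact: basis_free hB.
exists (linfun f) => //; split.
- exists (linfun g) => [|k x].
    rewrite (basis_pair_trace _ hB) !lfunE /= !linearZ /=.
    have -> : coord [tuple h1; h2] ord_max h1 = 0.
      exact: (coord_free ord0 ord_max hF).
    have -> : coord [tuple h1; h2] ord0 h1 = 1.
      exact: (coord_free ord0 ord0 hF).
    by rewrite mul0r mulr0 addr0.
  rewrite fE lfunE /= {1}(basis_pair_coords k hB) linearDl.
  by rewrite !linearZl_LR -!linearZr_LR p2_tensor.
- apply/eqP => /lfunP/(_ (t h2 e)); rewrite fE p2h2 zero_lfunE => /eqP.
  by rewrite tensor_eq0 (negPf h1F) (negPf e0).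
- exists 2%N; apply/lfunP => X.
  by rewrite !comp_lfunE !fE p2h1 linear0r zero_lfunE.
Qed.
End Basis.

Lemma lfun_exp_tensor (A : 'End(V)) (B : 'End(H)) (k : nat) (h : H) (e : E) :
  (forall h e, A (t h e) = t (B h) e) ->
  lfun_exp A k (t h e) = t (lfun_exp B k h) e.
Proof.
by move=> AB; elim: k => [|k IH]; rewrite /lfun_exp /= ?id_lfunE // !comp_lfunE IH.
Qed.

(** Any nonzero vector of ker B will do. If [B] is injective, so are its powers, and 0 = A^k (h (x)
    e) = B^k h (x) e with h nonzero forces e = 0, where the claim is trivial. *)
Lemma Qtilde_nilpotent_kernel (A : 'End(V)) : \dim {:H} = 2%N ->
  Qtilde_nilpotent t A -> exists2 h : H, h != 0 & forall e, A (t h e) = 0.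
Proof.
move=> dimH [[B _ AB] _ [k Ak0]].
have [/lker0P Binj|B0] := boolP (lker B == 0%VS); last first.
  exists (vpick (lker B)) => [|e]; first by rewrite vpick0.
  by have := memv_pick (lker B); rewrite memv_ker AB => /eqP->; rewrite linear0l.
have h0 : vpick {:H} != 0 by rewrite vpick0 -dimv_eq0 dimH.
exists (vpick {:H}) => // e.
have Bk0 : lfun_exp B k (vpick {:H}) != 0.
  elim: k {Ak0} => [|k IH]; rewrite /lfun_exp /= ?id_lfunE // comp_lfunE.
  by apply: contraNneq IH => BIH; apply/eqP/Binj; rewrite BIH linear0.
have [h2 hB] := basis_of_pair dimH h0.
have /eqP := lfun_exp_tensor k (vpick {:H}) e AB.
rewrite Ak0 zero_lfunE eq_sym (tensor_eq0 hB) (negPf Bk0) => /eqP->.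
by rewrite linear0r linear0.
Qed.

(** * Decomposable subspaces, degree 1 and the criterion for [A]-nilpotency *)

Lemma decomposable_degree1 (U : {vspace V}) : \dim {:H} = 2%N ->
  decomposable t U -> nilpotent_of_degree t U 1.
Proof.
move=> dimH [U0 [h [S US]]].
have UE X : X \in U -> exists2 e, e \in S & t h e = X.
  by move=> XU; have : [set` U] X by []; rewrite US.
(* A nonzero element h (x) e of [U] shows that both [h] and [e] are nonzero; the shear along [h]
   then kills all of [U]. *)
have [e _ tE] := UE _ (memv_pick U).
have /norP[h0 e0] : ~~ ((h == 0) || (e == 0)).
  apply/negP => he0; have := vpick0 U; rewrite (negPf U0) -tE.
  by case/orP: he0 => /eqP->; rewrite ?linear0l ?linear0r eqxx.
have [h2 hB] := basis_of_pair dimH h0.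
have [A AN AE] := shear_Qtilde_nilpotent hB e0.
have AU : (A @: U = 0)%VS.
  apply/eqP; rewrite -subv0; apply/subvP => _ /memv_imgP[X /UE[x _ <-] ->].
  have := p2_tensor hB x 0; rewrite linear0r addr0 => p0.
  by rewrite AE p0 linear0r mem0v.
have AUN : nilpotent_by t A U by split=> //; rewrite AU sub0v.
split; first by exists A.
- by exists A => //; rewrite /lfun_exp /= comp_lfun1r.
(* Only degree 0 has to be excluded: the zeroth power is the identity, which does not kill a nonzero
   [U]. *)
- case=> // -[A' _]; rewrite /lfun_exp /= lim1g => /eqP.
  by rewrite (negPf U0).
Qed.

Lemma degree1_decomposable (U : {vspace V}) : \dim {:H} = 2%N ->
  nilpotent_of_degree t U 1 -> decomposable t U.
Proof.
move=> dimH [_ [A [U0 AN _]]]; rewrite /lfun_exp /= comp_lfun1r => AU _.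
have [h h0 Ah] := Qtilde_nilpotent_kernel dimH AN.
have [h2 hB] := basis_of_pair dimH h0.
have [AQ A0 _] := AN; have [a a0 AE] := Qtilde_shear hB AQ Ah A0.
(* The factor in [E] is the preimage of [U] under e |-> h (x) e. It recovers all of [U] because [U]
   lies in ker A, where the second coordinate vanishes. *)
split=> //; exists h, (linfun (t h) @^-1: U)%VS; apply/seteqP; split=> X /=.
- move=> XU; have /eqP : A X = 0.
    by apply/eqP; rewrite -memv0 -AU memv_img.
  rewrite AE scaler_eq0 (negPf a0) (tensor_eq0 hB) (negPf h0) => /eqP p0.
  have XE := tensor_decomp hB X; rewrite p0 linear0r addr0 in XE.
  by exists (p1 t h h2 X) => //=; rewrite -memv_preim lfunE /= -XE.
- by move=> [e /=]; rewrite -memv_preim lfunE /= => eU <-.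
Qed.

Lemma nilpotent_byP (A : 'End(V)) (h h2 : H) (U : {vspace V}) :
  Qtilde_nilpotent t A -> (forall e, A (t h e) = 0) ->
  basis_of {:H} [:: h; h2] -> U != 0%VS ->
  nilpotent_by t A U <->
  tensor_set t h [set p2 t h h2 X | X in [set` U]] `<=` [set` U].
Proof.
move=> AN Ah hB U0; have [AQ A0 _] := AN.
have [a a0 AE] := Qtilde_shear hB AQ Ah A0; split.
- move=> [_ _ /subvP AU] _ [_ [X XU <-] <-] /=.
  (* The image A X is only a multiple of h (x) p2 X; dividing by the nonzero scalar [a] puts the
     latter in [U]. *)
  have := AU _ (memv_img A XU); rewrite AE => /(memvZ a^-1).
  by rewrite scalerA mulVf ?scale1r.
- move=> hU; split=> //; apply/subvP => _ /memv_imgP[X XU ->].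
  by rewrite AE; apply/memvZ/hU; exists (p2 t h h2 X) => //; exists X.
Qed.
End Tensor.

Theorem proposition3p25 (R : realType) (n : nat) (H E V : vectType R)
    (w : {skew_symmetric H}) (t : {bilinear H -> E -> V})
    (dimH : \dim {:H} = 2%N) (dimE : \dim {:E} = (2 * n)%N)
    (w_symplectic : is_psymplectic w) (t_tensor : is_tensor_product t) :
  (forall U : {vspace V}, U != 0%VS ->
     (nilpotent_of_degree t U 1 <-> decomposable t U)) /\
  (forall (A : 'End(V)) (h : H),
     Qtilde_nilpotent t A -> [set` lker A] = tensor_set t h [set: E] ->
     forall h2 : H, symplectic_basis w h h2 ->
     forall U : {vspace V}, U != 0%VS ->
       (nilpotent_by t A U <->
        tensor_set t h [set p2 t h h2 X | X in [set` U]] `<=` [set` U])).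
Proof.
split=> [U _|A h AN kerA h2 [hB _] U U0].
  by split; [exact: degree1_decomposable | exact: decomposable_degree1].
apply: nilpotent_byP => // e.
by have : tensor_set t h [set: E] (t h e); [exists e | rewrite -kerA /= memv_ker => /eqP].
Qed.
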